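(* Let $T$ be a topological space, $d\ge 1$, and let $\mathbb{E}$ be a linear space of functions $f:T\to\mathbb{R}^d$. Assume that all functions from $\mathbb{E}$ are jointly separable, that is, there exists a countable set $Q\subset T$ such that, for all $f\in\mathbb{E}$ and $t\in T$, $f(t)$ is the limit of $f(t_n)$ for some sequence $t_n\in Q$ with $t_n\to t$. Then, for each $j\ge 1$ and each $f_1,\dots,f_j\in\mathbb{E}$, $$\operatorname{band}_m(f_1,\dots,f_j)\downarrow\operatorname{conv}(f_1,\dots,f_j)\qquad\text{as } m\to\infty,$$ that is, $\operatorname{band}_{m+1}(f_1,\dots,f_j)\subset\operatorname{band}_m(f_1,\dots,f_j)$ for all $m\ge1$ and $\bigcap_{m\ge 1}\operatorname{band}_m(f_1,\dots,f_j)=\operatorname{conv}(f_1,\dots,f_j)$.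
   Context: For $f_1,\dots,f_j\in\mathbb{E}$: The convex hull $\operatorname{conv}(f_1,\dots,f_j)$ is the family of all $f\in\mathbb{E}$ of the form $f(t)=\sum_{i=1}^j\lambda_i f_i(t)$, $t\in T$, for some constants $\lambda_1,\dots,\lambda_j\ge 0$ (not depending on $t$) with $\sum_i\lambda_i=1$. For an integer $m\ge1$, the $m$-band $\operatorname{band}_m(f_1,\dots,f_j)$ is the family of all $f\in\mathbb{E}$ such that, for all $t_1,\dots,t_m\in T$ (not necessarily distinct), the vector $(f(t_1),\dots,f(t_m))\in(\mathbb{R}^d)^m$ belongs to the convex hull of the points $(f_i(t_1),\dots,f_i(t_m))$, $i=1,\dots,j$; i.e. $(f(t_1),\dots,f(t_m))=\sum_{i=1}^j\lambda_i(f_i(t_1),\dots,f_i(t_m))$ for some non-negative reals $\lambda_1,\dots,\lambda_j$ summing to one, which may depend on $(t_1,\dots,t_m)$. *)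

(* Defs.v *)
From HB Require Import structures.
From mathcomp Require Import all_boot all_order all_algebra.
From mathcomp Require Import all_classical all_reals.
From mathcomp Require Import topology normedtype.

Set Implicit Arguments.
Unset Strict Implicit.
Unset Printing Implicit Defensive.

Import Order.TTheory GRing.Theory Num.Theory.
Import numFieldNormedType.Exports.

Local Open Scope classical_set_scope.
Local Open Scope ring_scope.

Definition convex_weights (R : realType) (j : nat) : set ('I_j -> R) :=
  [set lam | (forall i, 0 <= lam i) /\ \sum_(i < j) lam i = 1].

Definition convex_hull_points (R : realType) (V : lmodType R) (j : nat)
    (x : 'I_j -> V) : set V :=
  [set \sum_(i < j) lam i *: x i | lam in @convex_weights R j].

(* The functions of the family are not required to be continuous, and the
   approximating sequence may depend on both f and t. *)
Definition jointly_separable (T S : topologicalType) (E : set (T -> S)) : Prop :=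
  exists2 Q : set T, countable Q &
    forall f t, E f -> exists u : nat -> T,
      [/\ forall n, Q (u n), u @ \oo --> t & f \o u @ \oo --> f t].

Section Bands.
Variables (R : realType) (T : topologicalType) (d : nat).
Variable E : set (T -> 'rV[R]_d).

Definition conv_family (j : nat) (f : 'I_j -> T -> 'rV[R]_d) : set (T -> 'rV[R]_d) :=
  [set g | E g /\ exists2 lam, @convex_weights R j lam &
     forall t, g t = \sum_(i < j) lam i *: f i t].

(* (R^d)^m is the left module 'I_m -> 'rV[R]_d with pointwise operations. *)
Definition band (m j : nat) (f : 'I_j -> T -> 'rV[R]_d) :
    set (T -> 'rV[R]_d) :=
  [set g | E g /\ forall t : 'I_m -> T,
     @convex_hull_points R ('I_m -> 'rV[R]_d) j
       (fun i k => f i (t k)) (fun k => g (t k))].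

End Bands.

(* Main.v *)
Require Import Defs.
From HB Require Import structures.
From mathcomp Require Import all_boot all_order all_algebra.
From mathcomp Require Import all_classical all_reals.
From mathcomp Require Import topology normedtype.

Set Implicit Arguments.
Unset Strict Implicit.
Unset Printing Implicit Defensive.

Import Order.TTheory GRing.Theory Num.Theory.
Import numFieldNormedType.Exports.

Local Open Scope classical_set_scope.
Local Open Scope ring_scope.

(** For a finite [s] in [T], the vectors [u] in [R^j] with
    [\sum_i u_i f_i(t) = 0] for all [t] in [s] form a subspace; choose [s] for
    which its dimension is minimal, so that every such [u] satisfies
    [\sum_i u_i f_i(t) = 0] for all [t] in [T].  If [g] is in every band, take
    weights [lam] representing [g] on [s], and for any [t] weights [lam']
    representing [g] on [t :: s]: then [lam - lam'] is in the subspace, so [lam]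
    also represents [g] at [t]. *)

Lemma finite_common_kernel (F : fieldType) (I : eqType) (n d : nat)
    (M : I -> 'M[F]_(n, d)) :
  exists s : seq I, forall (t : I) (u : 'rV[F]_n),
    (forall x, x \in s -> u *m M x = 0) -> u *m M t = 0.
Proof.
(* The row space of [K s] consists of the [u] killed by every [M x] with [x] in [s]; the empty list
   gives the whole space. *)
pose K := foldr (fun t (V : 'M[F]_n) => (V :&: kermx (M t))%MS) 1%:M.
have KP s (u : 'rV_n) : (forall x, x \in s -> u *m M x = 0) -> (u <= K s)%MS.
  elim: s => [|x s IHs] us /=; first exact: submx1.
  rewrite sub_capmx IHs => [|y ys]; last by apply: us; rewrite inE ys orbT.
  by apply/sub_kermxP/us; rewrite inE eqxx.
have [s minK] : exists s, forall s', (\rank (K s) <= \rank (K s'))%N.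
  pose P r := `[< exists s, \rank (K s) = r >].
  have exP : exists r, P r by exists (\rank (K [::])); apply/asboolP; exists [::].
  case: (ex_minnP exP) => r /asboolP[s <-] minr.
  by exists s => s'; apply: minr; apply/asboolP; exists s'.
exists s => t u /KP us; apply/sub_kermxP/(submx_trans us).
(* Minimality of the rank at [s] turns this inclusion into an equality of row spaces, so [K s]
   already lies in the kernel of [M t]. *)
have /mxrank_leqif_sup[_] : (K (t :: s) <= K s)%MS by exact: capmxSl.
rewrite eqn_leq mxrankS ?capmxSl// minK => /esym Ks.
by apply: submx_trans Ks _; exact: capmxSr.
Qed.

Lemma convex_weights_neq0 (R : realType) (j : nat) :
  (0 < j)%N -> @convex_weights R j !=set0.
Proof.
case: j => // j _; exists (fun i => (i == ord0)%:R); split=> [i|].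
  exact: ler0n.
by rewrite (bigD1 ord0)//= big1 ?addr0// => i /negPf ->.
Qed.

Section Bands.
Variables (R : realType) (T : topologicalType) (d : nat).
Variables (E : set (T -> 'rV[R]_d)) (j : nat) (f : 'I_j -> T -> 'rV[R]_d).
Implicit Type g : T -> 'rV[R]_d.

Lemma bandP m g : band E m f g <->
  E g /\ forall t : 'I_m -> T, exists2 lam, @convex_weights R j lam &
    forall k, g (t k) = \sum_(i < j) lam i *: f i (t k).
Proof.
split=> -[Eg gP]; split=> // t; have [lam lamP lamE] := gP t; exists lam => //.
  by move=> k; have /(congr1 (@^~ k)) /= <- := lamE; rewrite fct_sumE.
by apply/funext => k; rewrite fct_sumE lamE.
Qed.

Lemma band_subset m n : (0 < m <= n)%N -> band E n f `<=` band E m f.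
Proof.
case: m => // m /= le_mn g /bandP[Eg gP]; apply/bandP; split=> // t.
(* The tuple [t] is padded to [n] points: [inord] sends every index out of range to [ord0], which
   exists since the shorter length is positive. *)
have [lam lamP lamE] := gP (t \o inord \o val); exists lam => // k.
by have := lamE (widen_ord le_mn k); rewrite /= inord_val.
Qed.

Lemma conv_family_sub_band m : conv_family E f `<=` band E m f.
Proof.
by move=> g [Eg [lam lamP lamE]]; apply/bandP; split=> // t; exists lam.
Qed.

Lemma bigcap_band_sub_conv_family : (0 < j)%N ->
  \bigcap_(m in [set m : nat | (1 <= m)%N]) band E m f `<=` conv_family E f.
Proof.
move=> j_gt0 g gP; split; first by have /bandP[] := gP 1%N (leqnn 1).
have fin (s : seq T) : exists2 lam, @convex_weights R j lam &
    forall t, t \in s -> g t = \sum_(i < j) lam i *: f i t.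
  (* The intersection starts at [m = 1], so no band covers the empty list; there any weights do, and
     [0 < j] supplies some. *)
  case: s => [|x s]; first by have [lam] := convex_weights_neq0 R j_gt0; exists lam.
  have /bandP[_ /(_ (tnth (in_tuple (x :: s))))[lam lamP lamE]] :=
    gP (size (x :: s)) (ltn0Sn _).
  by exists lam => // t /(tnthP (in_tuple _))[k ->].
(* Row [i] is [f i t], so the left kernel of [M t] is the space of linear relations among the [f i]
   at [t]. *)
pose M t := \matrix_(i < j) f i t.
have mulM (lam : 'I_j -> R) t :
    (\row_i lam i) *m M t = \sum_(i < j) lam i *: f i t.
  by rewrite mulmx_sum_row; apply: eq_bigr => i _; rewrite rowK mxE.
have [s sP] := finite_common_kernel M.
have [lam lamP lamE] := fin s; exists lam => // t.
have [lam' _ lam'E] := fin (t :: s).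
(* The goal becomes that the difference of the two weight rows is killed by [M t]; by [sP] it is
   enough to check this on [s]. *)
rewrite lam'E ?mem_head// -!mulM; apply/eqP; rewrite -subr_eq0 -mulmxBl.
apply/eqP/sP => x xs.
by rewrite mulmxBl !mulM -lamE// -lam'E ?subrr// inE xs orbT.
Qed.

End Bands.

Theorem proposition1 (R : realType) (T : topologicalType) (d : nat)
    (d_ge1 : (1 <= d)%N) (E : set (T -> 'rV[R]_d))
    (linE : submod_closed [in E]) (sepE : jointly_separable E)
    (j : nat) (j_ge1 : (1 <= j)%N) (f : 'I_j -> T -> 'rV[R]_d)
    (fE : forall i, E (f i)) :
  (forall m : nat, (1 <= m)%N -> band E m.+1 f `<=` band E m f) /\
  \bigcap_(m in [set m : nat | (1 <= m)%N]) band E m f = conv_family E f.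
Proof.
split=> [m m_ge1|]; first by apply: band_subset; rewrite m_ge1 leqnSn.
apply/seteqP; split; first exact: bigcap_band_sub_conv_family.
by move=> g gP m _; exact: conv_family_sub_band.
Qed.
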